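(* Let $\mathbf{k}$ be a function field over an uncountable field of characteristic zero, and let $B=\mathbf{k}[X,Y]$ be a polynomial ring in two variables over $\mathbf{k}$. Then there exists a degree function $\deg : B \to \mathbb{N}\cup\{-\infty\}$ such that $\deg(\lambda)=0$ for all $\lambda\in\mathbf{k}^*$ and with respect to which the degree of $\frac{\partial}{\partial X} : B\to B$ is not defined.
   Context: $\mathbb{N}$ includes $0$. A function field over a field is a finitely generated field extension of transcendence degree at least $1$. A degree function on a ring $B$ with values in a totally ordered abelian group $G$ is a map $\deg : B \to G\cup\{-\infty\}$ such that for all $x,y\in B$: (1) $\deg(x)=-\infty$ iff $x=0$; (2) $\deg(xy)=\deg x+\deg y$; (3) $\deg(x+y)\le\max(\deg x,\deg y)$. A degree function $B\to\mathbb{N}\cup\{-\infty\}$ is a degree function with $G=\mathbb{Z}$ whose values on $B\setminus\{0\}$ lie in $\mathbb{N}$. For a derivation $D:B\to B$ of an integral domain $B$ with degree function $\deg$, let $U=\{\deg(Dx)-\deg(x) : x\in B\setminus\{0\}\}\subseteq G\cup\{-\infty\}$. If $U$ has a greatest element, $\deg(D)$ is defined to be that element; otherwise $\deg(D)$ is said to be not defined. (For $G=\mathbb{Z}$, $\deg(D)$ is defined iff $U$ is bounded above.) *)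

(* Defs.v *)
From mathcomp Require Import all_boot all_order all_algebra.
From mathcomp Require Import mpoly.
From mathcomp Require Import boolp classical_sets cardinality.

Set Implicit Arguments.
Unset Strict Implicit.
Unset Printing Implicit Defensive.

Import Order.TTheory GRing.Theory Num.Theory.
Local Open Scope classical_set_scope.
Local Open Scope ring_scope.

(* Z together with -oo, which is represented by [None]. *)
Definition zbot := option int.

Definition zbot_le (a b : zbot) : bool :=
  match a, b with
  | None, _ => true
  | Some _, None => false
  | Some m, Some n => m <= n
  end.

Definition zbot_max (a b : zbot) : zbot := if zbot_le a b then b else a.

Definition zbot_add (a b : zbot) : zbot :=
  match a, b with
  | Some m, Some n => Some (m + n)
  | _, _ => None
  end.

(* Only meaningful when [b] is finite; [zbot_sub a None] is a junk value, and
   [degree_shifts] below only subtracts degrees of nonzero elements. *)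
Definition zbot_sub (a b : zbot) : zbot :=
  match a, b with
  | Some m, Some n => Some (m - n)
  | _, _ => None
  end.

Definition degree_function (B : nzRingType) (deg : B -> zbot) : Prop :=
  [/\ forall x, deg x = None <-> x = 0,
      forall x y, deg (x * y) = zbot_add (deg x) (deg y)
    & forall x y, zbot_le (deg (x + y)) (zbot_max (deg x) (deg y))].

Definition nat_degree_function (B : nzRingType) (deg : B -> zbot) : Prop :=
  degree_function deg /\
  forall x, x != 0 -> exists n : nat, deg x = Some n%:Z.

Definition degree_shifts (B : nzRingType) (deg : B -> zbot) (D : B -> B) :
    set zbot :=
  [set zbot_sub (deg (D x)) (deg x) | x in [set x | x != 0]].

Definition degree_defined (B : nzRingType) (deg : B -> zbot) (D : B -> B) :
    Prop :=
  exists2 u, degree_shifts deg D u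
           & forall w, degree_shifts deg D w -> zbot_le w u.

Section FieldExtension.
Variables (F K : fieldType) (iota : {rmorphism F -> K}).

(* [x] lies in F(s), the smallest subfield of K containing F and s. *)
Definition in_adjoin (s : seq K) (x : K) : Prop :=
  forall S : {pred K}, GRing.divring_closed S ->
    (forall c, iota c \in S) -> {subset s <= S} -> x \in S.

Definition finitely_generated_ext : Prop :=
  exists s : seq K, forall x, in_adjoin s x.

Definition alg_independent (n : nat) (v : 'I_n -> K) : Prop :=
  forall p : {mpoly F[n]}, (map_mpoly iota p).@[v] = 0 -> p = 0.

(* The transcendence degree is the largest size of an algebraically
   independent family. *)
Definition has_trdeg (n : nat) : Prop :=
  (exists v : 'I_n -> K, alg_independent v) /\
  forall (m : nat) (v : 'I_m -> K), alg_independent v -> (m <= n)%N.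

Definition function_field : Prop :=
  finitely_generated_ext /\ exists2 n : nat, (1 <= n)%N & has_trdeg n.

End FieldExtension.

(* Main.v *)
(** Put [tau_n = t - N - n] with [t] transcendental over [k0], and consider the
    polynomials [p_0 = Y], [p_(n+1) = p_n ^ 2 - tau_n X ^ 2] of [k[X, Y]].  The
    monomials [X ^ i p_0 ^ e_0 p_1 ^ e_1 ...] with all [e_j <= 1] form a
    [k]-basis of [k[X, Y]], and the degree gives weight 1 to [X] and to every
    [p_n].  The associated graded ring is [k[X, P_0, P_1, ...] / (P_n ^ 2 - tau_n X ^ 2)];
    it embeds in [L[X]] by [P_n |-> sqrt(tau_n) X], hence is a domain, as soon
    as no product of distinct [tau_n] is a square in [k].  This gives a degree
    function for which [p_n] has degree 1, whereas its derivative with respect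
    to [X] has degree [n] because [p_(n+1)' = 2 p_n p_n' - 2 tau_n X].

    Independence of the [tau_n] modulo squares: it holds over
    [k0(v_1, ..., v_r)], with [t] one of the [v_i], because [t - c] divides a
    square to an even order.  The remaining generators [x] of [k] are adjoined
    one at a time; if some product of shifts becomes a square [w ^ 2] in
    [F(x)], then one passes to [F(w)], over which [x] has smaller degree, at
    the cost of discarding finitely many shifts. *)
Require Import Defs.
From HB Require Import structures.
From mathcomp Require Import all_boot all_order all_algebra all_field.
From mathcomp Require Import mpoly.
From mathcomp Require Import boolp classical_sets cardinality.
From mathcomp Require Import ring zify.
Set Implicit Arguments.
Unset Strict Implicit.
Unset Printing Implicit Defensive.
Import GRing.Theory.
Local Open Scope ring_scope.

(** * Square classes and quadratic extensions *)

(** Linear independence, over the field with two elements, of the classes of [us] modulo squares.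
    Masks select by position, so repeated entries are excluded, and so are zero entries, 0 being a
    square. *)
Definition sq_indep (F : fieldType) (us : seq F) : Prop :=
  forall (m : bitseq) (z : F), size m = size us ->
    z ^+ 2 = \prod_(u <- mask m us) u -> ~~ has id m.

Lemma sq_indep_rcons_notsq (F : fieldType) (us : seq F) (a : F) :
  sq_indep (rcons us a) -> forall z, z ^+ 2 != a.
Proof.
move=> ind z; apply/eqP => za.
have := ind (rcons (nseq (size us) false) true) z.
rewrite !size_rcons size_nseq => /(_ erefl).
rewrite mask_rcons ?size_nseq // mask_false /= big_seq1 => /(_ za).
by rewrite has_rcons.
Qed.

Lemma quadratic_extension (F : fieldType) (a : F) :
  (forall z, z ^+ 2 != a) ->
  exists (L : fieldType) (j : {rmorphism F -> L}) (s : L),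
    s ^+ 2 = j a /\ forall z, exists x y, z = j x + j y * s.
Proof.
move=> nsq.
have sz : size ('X^2 - a%:P) = 3 by rewrite size_XnsubC.
have irr : irreducible_poly ('X^2 - a%:P).
  apply: cubic_irreducible; first by rewrite sz.
  by move=> x; apply/negP => /rootP /eqP; rewrite !hornerE subr_eq0 (negPf (nsq x)).
have [L dimL [s rs gs]] := irredp_FAdjoin irr.
exists L, (in_alg L), s; split.
  move/rootP: rs; rewrite rmorphB /= map_polyXn map_polyC /= !hornerE.
  by move/eqP; rewrite subr_eq0 => /eqP.
move=> z.
have zin : z \in <<1; s>>%VS by rewrite gs memvf.
have deg2 : (adjoin_degree 1%AS s <= 2)%N.
  by have := dimL; rewrite sz -gs dim_Fadjoin dimv1 muln1 => ->.
have /polyOver1P [q Dq] := Fadjoin_polyOver 1%AS s z.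
have szq : (size q <= 2)%N.
  have := size_Fadjoin_poly 1%AS s z.
  rewrite Dq size_map_poly => h; exact: leq_trans h deg2.
exists q`_0, q`_1.
rewrite -{1}(Fadjoin_poly_eq zin) Dq horner_coef size_map_poly.
rewrite (big_ord_widen 2 (fun i => (map_poly (in_alg L) q)`_i * s ^+ i)) //.
rewrite big_mkcond !big_ord_recl big_ord0 /= !coef_map /= expr0 expr1 mulr1 addr0 /bump /=.
by case: ltnP => [_|/(nth_default 0)->]; case: ltnP => [_|/(nth_default 0)->];
  rewrite ?scale0r ?mul0r.
Qed.

Section Quadratic.
Variables (F L : fieldType) (j : {rmorphism F -> L}) (s : L) (a : F).
Hypotheses (sqs : s ^+ 2 = j a) (nsq : forall z, z ^+ 2 != a).

Lemma quadratic_free x y : j x + j y * s = 0 -> x = 0 /\ y = 0.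
Proof.
move=> /eqP h; have [y0|yN0] := eqVneq y 0.
  move: h; rewrite y0 rmorph0 mul0r addr0 fmorph_eq0 => /eqP ->; by split.
move: h; rewrite addrC addr_eq0 => /eqP h.
have jy : j y != 0 by rewrite fmorph_eq0.
have sE : s = j (- x / y).
  by rewrite fmorph_div rmorphN /= -h mulrC mulKf.
have /eqP := sqs; rewrite sE -rmorphXn /= (inj_eq (fmorph_inj j)).
by rewrite (negPf (nsq _)).
Qed.

Hypotheses (two : (2%:R : F) != 0).
Hypothesis (gen : forall z, exists x y, z = j x + j y * s).

(** Writing z = x + y s, the coefficient of s in z^2 = u gives 2 x y = 0. If y = 0 then u = x^2; if
    x = 0 then u = a y^2, so that u a = (a y)^2. *)
Lemma quadratic_square (u : F) (z : L) :
  z ^+ 2 = j u -> exists x, x ^+ 2 = u \/ x ^+ 2 = u * a.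
Proof.
have [x [y ->]] := gen z => h.
have : j (x ^+ 2 + a * y ^+ 2 - u) + j (2%:R * x * y) * s = 0.
  rewrite !(rmorphB, rmorphD, rmorphM) /= rmorph1 -h -sqs; ring.
case/quadratic_free => /eqP h1 /eqP.
rewrite !mulf_eq0 (negPf two) /= => /orP[]/eqP z0; move: h1; rewrite z0 expr0n /=.
  by rewrite add0r subr_eq0 => /eqP <-; exists (a * y); right; ring.
by rewrite mulr0 addr0 subr_eq0 => /eqP <-; exists x; left.
Qed.
End Quadratic.

(** By [quadratic_square], a subproduct of [us] that becomes a square in L is, up to a factor [a],
    already a square in F. Extending the mask by one bit for [a] contradicts the independence of
    [rcons us a]. *)
Lemma sq_indep_quadratic (F L : fieldType) (j : {rmorphism F -> L}) (s : L)
    (us : seq F) (a : F) :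
  s ^+ 2 = j a -> (2%:R : F) != 0 -> (forall z, exists x y, z = j x + j y * s) ->
  sq_indep (rcons us a) -> sq_indep (map j us).
Proof.
move=> sqs two gen ind m z; rewrite size_map => szm.
rewrite -map_mask big_map -rmorph_prod /= => zE.
have [x [xE|xE]] := quadratic_square sqs (sq_indep_rcons_notsq ind) two gen zE.
  have := ind (rcons m false) x; rewrite !size_rcons szm => /(_ erefl).
  by rewrite mask_rcons // cats0 has_rcons /=; apply.
have := ind (rcons m true) x; rewrite !size_rcons szm => /(_ erefl).
by rewrite mask_rcons // big_cat big_seq1 has_rcons /= => /(_ xE).
Qed.

(** * Expansion along the key polynomials and the weight *)

Section Decomposition.
Variables (K : fieldType).
Implicit Types (f g h : {poly {poly K}}) (t : K).

(** The outer variable is Y and coefficients are polynomials in X. With p = Y^2 - t X^2,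
    substituting Y^2 = p + t X^2 in the even and odd parts of f gives f = (ev t f)(p) + Y (od t
    f)(p). *)
Definition cst t : {poly {poly K}} := (t *: 'X^2)%:P.
Definition ev t f := even_poly f \Po ('X + cst t).
Definition od t f := odd_poly f \Po ('X + cst t).

Lemma evD t : {morph ev t : f g / f + g}.
Proof. by move=> f g; rewrite /ev even_polyD comp_polyD. Qed.
Lemma odD t : {morph od t : f g / f + g}.
Proof. by move=> f g; rewrite /od odd_polyD comp_polyD. Qed.
Lemma evZ t c f : ev t (c *: f) = c *: ev t f.
Proof. by rewrite /ev even_polyZ comp_polyZ. Qed.
Lemma odZ t c f : od t (c *: f) = c *: od t f.
Proof. by rewrite /od odd_polyZ comp_polyZ. Qed.
Lemma evC t c : ev t c%:P = c%:P.
Proof. by rewrite /ev even_polyC comp_polyC. Qed.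
Lemma odC t c : od t c%:P = 0.
Proof. by rewrite /od odd_polyC comp_poly0. Qed.
Lemma evMX t f : ev t (f * 'X) = od t f * ('X + cst t).
Proof. by rewrite /ev even_polyMX comp_polyM comp_polyX. Qed.
Lemma odMX t f : od t (f * 'X) = ev t f.
Proof. by rewrite /od odd_polyMX. Qed.

Lemma evod_mul t f g :
  ev t (f * g) = ev t f * ev t g + od t f * od t g * ('X + cst t) /\
  od t (f * g) = ev t f * od t g + od t f * ev t g.
Proof.
elim/poly_ind: f => [|f c [IHe IHo]].
  by rewrite mul0r -{1 2 5 6}polyC0 evC odC polyC0 !mul0r !addr0.
have -> : (f * 'X + c%:P) * g = f * g * 'X + c *: g.
  by rewrite -mul_polyC; ring.
rewrite !(evD, odD, evMX, odMX, evC, odC, evZ, odZ) IHe IHo -!mul_polyC; split; ring.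
Qed.

Lemma size_ev_le t f n : (size f <= n.*2)%N -> (size (ev t f) <= n)%N.
Proof.
move=> szf; rewrite /ev size_comp_poly2 ?size_XaddC //.
by apply: leq_trans (size_even_poly f) _; rewrite leq_uphalf_double.
Qed.
Lemma size_od_le t f n : (size f <= n.*2.+1)%N -> (size (od t f) <= n)%N.
Proof.
move=> szf; rewrite /od size_comp_poly2 ?size_XaddC //.
by apply: leq_trans (size_odd_poly f) _; rewrite leq_half_double.
Qed.

Lemma evod_eq0 t f : ev t f = 0 -> od t f = 0 -> f = 0.
Proof.
have sz : size (('X : {poly {poly K}}) + cst t) = 2 by rewrite size_XaddC.
move=> /eqP; rewrite comp_poly2_eq0 // => /eqP e0.
move=> /eqP; rewrite comp_poly2_eq0 // => /eqP o0.
by rewrite -(poly_even_odd f) e0 o0 !comp_poly0 mul0r addr0.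
Qed.

Lemma evod_comp t h :
  ev t (h \Po ('X^2 - cst t)) = h /\ od t (h \Po ('X^2 - cst t)) = 0.
Proof.
have [eq oq] : ev t ('X^2 - cst t) = 'X /\ od t ('X^2 - cst t) = 0.
  have -> : 'X^2 - cst t = 1%:P * 'X * 'X + (- (t *: 'X^2))%:P.
    by rewrite polyCN mul1r.
  rewrite !(evD, odD, evMX, odMX, evC, odC) polyCN -/(cst t); split; ring.
elim/poly_ind: h => [|h c [IHe IHo]].
  by rewrite comp_poly0 -polyC0 evC odC.
rewrite comp_poly_MXaddC evD odD evC odC.
have [-> ->] := evod_mul t (h \Po ('X^2 - cst t)) ('X^2 - cst t).
by rewrite eq oq IHe IHo; split; ring.
Qed.

(* [wsize] is one more than the weight, and [0] for the zero polynomial. *)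
Fixpoint wsize (ts : seq K) f : nat :=
  if ts is t :: ts' then
    maxn (wsize ts' (ev t f))
         (if wsize ts' (od t f) is w.+1 then w.+2 else 0%N)
  else size f`_0.

Lemma wsizeC ts c : wsize ts c%:P = size c.
Proof.
elim: ts c => [|t ts IH] c /=; first by rewrite coefC.
by rewrite evC odC -polyC0 !IH size_poly0 maxn0.
Qed.

Lemma wsize0 ts : wsize ts 0 = 0%N.
Proof. by rewrite -polyC0 wsizeC size_poly0. Qed.

(** Once [ts] is exhausted [wsize] sees only the constant coefficient. Each splitting halves the
    bound on the size in Y, so under this bound nothing is lost. *)
Lemma wsize_eq0 ts f : (size f <= 2 ^ size ts)%N -> wsize ts f = 0%N -> f = 0.
Proof.
elim: ts f => [|t ts IH] f /=.
  by move=> /size1_polyC -> /eqP; rewrite coefC size_poly_eq0 => /eqP ->.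
rewrite expnS mul2n => szf w0.
have [we wo] : wsize ts (ev t f) = 0%N /\ wsize ts (od t f) = 0%N.
  by move: w0; case: (wsize ts (ev t f)); case: (wsize ts (od t f)) => //=; lia.
apply: (@evod_eq0 t); apply: IH => //; first exact: size_ev_le.
exact/size_od_le/leqW.
Qed.

Lemma wsize_stable ts ts' f :
  (size f <= 2 ^ size ts)%N -> wsize (ts ++ ts') f = wsize ts f.
Proof.
elim: ts f => [|t ts IH] f /=.
  by move=> /size1_polyC ->; rewrite wsizeC coefC.
rewrite expnS mul2n => szf; rewrite !IH //; last exact: size_ev_le.
exact/size_od_le/leqW.
Qed.
End Decomposition.

(** * Leading symbols in a polynomial ring over an extension field *)

(** The model is the K[X]-semilinear map sending a basis monomial in the p_n to its image under p_n
    |-> sqrt(tau_n) X. It is multiplicative only up to terms of degree below d + e, sizes being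
    degrees plus one; the bounds on [size f] keep products within reach of [wsize]. *)
Record symbol_map (K L : fieldType) (j : {rmorphism K -> L}) (ts : seq K)
    (S : {poly {poly K}} -> {poly L}) : Prop := SymbolMap {
  symD : {morph S : f g / f + g};
  symZ : forall c (f : {poly {poly K}}), S (c *: f) = map_poly j c * S f;
  size_sym : forall f, size (S f) = wsize ts f;
  size_symMX : forall f : {poly {poly K}}, (size f < 2 ^ size ts)%N ->
    (size (S (f * 'X)%R) <= (size (S f)).+1)%N;
  size_symM : forall (f g : {poly {poly K}}) d e, (size f + size g <= (2 ^ size ts).+1)%N ->
    (size (S f) <= d.+1)%N -> (size (S g) <= e.+1)%N ->
    (size (S (f * g) - S f * S g)%R <= d + e)%N }.

Lemma size_mulX_leq (R : nzRingType) (p : {poly R}) n :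
  (size p <= n)%N -> (size (p * 'X)%R <= n.+1)%N.
Proof.
have [->|pN0] := eqVneq p 0; first by rewrite mul0r size_poly0.
by rewrite size_mulX // ltnS.
Qed.

(** Since 1 and s are independent over F, no cancellation occurs between the two summands. *)
Lemma size_quadratic (F L : fieldType) (j : {rmorphism F -> L}) (s : L)
    (p q : {poly F}) :
  (forall x y, j x + j y * s = 0 -> x = 0 /\ y = 0) ->
  size (map_poly j p + s *: map_poly j q) = maxn (size p) (size q).
Proof.
move=> free; set P := (X in size X).
have coefP i : P`_i = j p`_i + j q`_i * s.
  by rewrite /P coefD coefZ !coef_map mulrC.
apply/eqP; rewrite eqn_leq; apply/andP; split.
  apply/leq_sizeP => i; rewrite geq_max => /andP[pi qi].
  by rewrite coefP !nth_default // rmorph0 mul0r addr0.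
have coef0 i : (size P <= i)%N -> p`_i = 0 /\ q`_i = 0.
  by move=> le_i; apply: free; rewrite -coefP nth_default.
by rewrite geq_max; apply/andP; split; apply/leq_sizeP => i /coef0[].
Qed.

Section SymbolStep.
Variables (K L' L : fieldType) (j : {rmorphism K -> L'}).
Variables (i : {rmorphism L' -> L}) (s : L) (t : K) (ts : seq K).
Variable S' : {poly {poly K}} -> {poly L'}.
Hypotheses (sS' : symbol_map j ts S') (sqs : s ^+ 2 = i (j t)).
Hypothesis free : forall x y, i x + i y * s = 0 -> x = 0 /\ y = 0.

(** Y is sent to s X, where s is a square root of t; the two coordinates, polynomials in p_1 = Y^2 -
    t X^2, are left to [S']. *)
Let S f : {poly L} :=
  map_poly i (S' (ev t f)) + s *: map_poly i (S' (od t f) * 'X).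

Let S'0 : S' 0 = 0.
Proof. by rewrite -(scale0r (0 : {poly {poly K}})) (symZ sS') rmorph0 mul0r. Qed.

Let S'_cst (f : {poly {poly K}}) : S' (f * cst t) = (j t *: 'X^2) * S' f.
Proof. by rewrite mulrC mul_polyC (symZ sS') map_polyZ map_polyXn. Qed.

(** The factor X attached to the odd coordinate leaves it degree at most d - 1. A zero odd
    coordinate is set apart because then d may be 0. *)
Let od_bound f d : (size (S f) <= d.+1)%N -> (size f <= (2 ^ size ts).*2)%N ->
  (size (S' (ev t f)) <= d.+1)%N /\
  (od t f = 0 \/ exists2 d', d = d'.+1 & (size (S' (od t f)) <= d'.+1)%N).
Proof.
rewrite size_quadratic // geq_max => /andP[hA hB] szf; split=> //.
have [o0|oN0] := eqVneq (od t f) 0; [by left | right].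
have SN0 : S' (od t f) != 0.
  rewrite -size_poly_eq0 (size_sym sS'); apply: contra oN0 => /eqP w0.
  by apply/eqP; apply: wsize_eq0 w0; exact/size_od_le/leqW.
move: hB; rewrite size_mulX // ltnS => hB.
have : (0 < d)%N by apply: leq_trans hB; rewrite size_poly_gt0.
by case: d hA hB => // d' _ hB _; exists d'.
Qed.

(** Multiplication by Y swaps the coordinates and multiplies the old odd one by p_1 + t X^2. This
    raises its degree by at most 2, of which 1 was already counted by the factor X in [S]. *)
Lemma symbol_step_mulX (f : {poly {poly K}}) : (size f < 2 ^ (size ts).+1)%N ->
  (size (S (f * 'X)%R) <= (size (S f)).+1)%N.
Proof.
rewrite expnS mul2n => szf.
rewrite !size_quadratic // evMX odMX mulrDr (symD sS') S'_cst geq_max.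
have [o0|oN0] := eqVneq (od t f) 0.
  rewrite o0 !(S'0, mul0r) mulr0 addr0 size_poly0 maxn0 leq0n /=.
  exact: size_mulX_leq.
have szo : (size (od t f) < 2 ^ size ts)%N.
  rewrite -(prednK (_ : 0 < 2 ^ size ts)%N) ?expn_gt0 // ltnS.
  by apply: size_od_le; lia.
have SN0 : S' (od t f) != 0.
  rewrite -size_poly_eq0 (size_sym sS'); apply: contra oN0 => /eqP w0.
  by apply/eqP; apply: wsize_eq0 w0; exact: ltnW.
rewrite size_mulX // size_mulX_leq ?leq_maxl // andbT.
have hS := size_symMX sS' szo.
rewrite (leq_trans (size_polyD _ _)) // geq_max.
rewrite (leq_trans hS) ?ltnS ?leq_max ?leqnSn ?orbT //=.
rewrite -scalerAl (leq_trans (size_scale_leq _ _)) //.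
by rewrite mulrC size_mulXn // add2n ltnS leq_max leqnn orbT.
Qed.

(** The bound for [S'] applies to the four products of coordinates. The remaining term b b' p_1,
    from Y^2 = p_1 + t X^2, has weight below d + e because p_1 counts 1 where Y^2 counts 2. *)
Lemma symbol_step_mul (f g : {poly {poly K}}) d e : (size f + size g <= (2 ^ (size ts).+1).+1)%N ->
  (size (S f) <= d.+1)%N -> (size (S g) <= e.+1)%N ->
  (size (S (f * g) - S f * S g)%R <= d + e)%N.
Proof.
rewrite expnS mul2n => szfg hf hg.
have [->|fN0] := eqVneq f 0.
  rewrite mul0r /S /ev /od -polyC0 even_polyC odd_polyC polyC0 !comp_poly0.
  by rewrite !(S'0, mul0r, rmorph0, scaler0, addr0, subr0) size_poly0.
have [->|gN0] := eqVneq g 0.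
  rewrite mulr0 /S /ev /od -polyC0 even_polyC odd_polyC polyC0 !comp_poly0.
  by rewrite !(S'0, mul0r, mulr0, rmorph0, scaler0, addr0, subr0) size_poly0.
have sf1 : (0 < size f)%N by rewrite size_poly_gt0.
have sg1 : (0 < size g)%N by rewrite size_poly_gt0.
have [hA hB] := od_bound hf ltac:(lia).
have [hA' hB'] := od_bound hg ltac:(lia).
have sa : (size (ev t f) <= uphalf (size f))%N by apply: size_ev_le; lia.
have sb : (size (od t f) <= (size f)./2)%N by apply: size_od_le; lia.
have sa' : (size (ev t g) <= uphalf (size g))%N by apply: size_ev_le; lia.
have sb' : (size (od t g) <= (size g)./2)%N by apply: size_od_le; lia.
rewrite /S; have [-> ->] := evod_mul t f g.
move: hA hB hA' hB' sa sb sa' sb'.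
move: (ev t f) (od t f) (ev t g) (od t g) => a b a' b'.
move=> hA hB hA' hB' sa sb sa' sb'.
rewrite mulrDr !(symD sS') S'_cst.
set E := (X in (size (polyseq X) <= _)%N).
have -> : E = map_poly i (S' (a * a') - S' a * S' a' + S' (b * b' * 'X) +
                 (j t *: 'X^2) * (S' (b * b') - S' b * S' b')) +
              s *: map_poly i ((S' (a * b') - S' a * S' b') * 'X +
                 (S' (b * a') - S' b * S' a') * 'X).
  rewrite /E !(rmorphD, rmorphB, rmorphM) /= !map_polyZ !map_polyXn /= map_polyX.
  rewrite -sqs -!mul_polyC rmorphXn; ring.
rewrite size_quadratic // geq_max; apply/andP; split.
  rewrite (leq_trans (size_polyD _ _)) // geq_max; apply/andP; split.
    rewrite (leq_trans (size_polyD _ _)) // geq_max; apply/andP; split.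
      by apply: (size_symM sS') => //; lia.
    have [->|bN0] := eqVneq b 0; first by rewrite !mul0r S'0 size_poly0.
    have [->|bN0'] := eqVneq b' 0; first by rewrite mulr0 mul0r S'0 size_poly0.
    case: hB => [/eqP|[d' -> hB]]; first by rewrite (negPf bN0).
    case: hB' => [/eqP|[e' -> hB']]; first by rewrite (negPf bN0').
    have := size_polyMleq b b' => szbb.
    have hbb : (size (S' (b * b')%R) <= (d' + e').+1)%N.
      rewrite -[S' _](subrK (S' b * S' b')).
      rewrite (leq_trans (size_polyD _ _)) // geq_max; apply/andP; split.
        by apply/leqW/(size_symM sS') => //; lia.
      by apply: leq_trans (size_polyMleq _ _) _; lia.
    apply: leq_trans (size_symMX sS' _) _; last by lia.
    have : (0 < size b)%N by rewrite size_poly_gt0.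
    by move=> ?; apply: leq_ltn_trans szbb _; lia.
  case: hB => [->|[d' -> hB]]; first by rewrite !(mul0r, S'0, subr0, mulr0) size_poly0.
  case: hB' => [->|[e' -> hB']]; first by rewrite !(mulr0, S'0, subr0) size_poly0.
  rewrite -scalerAl (leq_trans (size_scale_leq _ _)) // expr2 mulrC mulrA.
  rewrite addSn addnS; do 2 apply: size_mulX_leq.
  by apply: (size_symM sS') => //; lia.
rewrite (leq_trans (size_polyD _ _)) // geq_max; apply/andP; split.
  case: hB' => [->|[e' -> hB']]; first by rewrite !(mulr0, S'0, subr0, mul0r) size_poly0.
  rewrite addnS; apply: size_mulX_leq.
  by apply: (size_symM sS') => //; lia.
case: hB => [->|[d' -> hB]]; first by rewrite !(mul0r, S'0, subr0) size_poly0.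
rewrite addSn; apply: size_mulX_leq.
by apply: (size_symM sS') => //; lia.
Qed.

Lemma symbol_step : symbol_map (i \o j) (t :: ts) S.
Proof.
split.
- move=> f g; rewrite /S evD odD !(symD sS') mulrDl !rmorphD scalerDr; ring.
- move=> c f; rewrite /S evZ odZ !(symZ sS') map_poly_comp -mulrA !rmorphM mulrDr.
  by rewrite scalerAr.
- move=> f; rewrite size_quadratic // /= -!(size_sym sS').
  congr maxn; have [->|oN0] := eqVneq (S' (od t f)) 0; first by rewrite mul0r size_poly0.
  by rewrite size_mulX // (polySpred oN0).
- exact: symbol_step_mulX.
- exact: symbol_step_mul.
Qed.
End SymbolStep.

(** The list [us] makes the induction work: the head t of [ts] joins [us] while the roots of the
    tail are adjoined, hence is still not a square, and its own root comes last. *)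
Lemma symbol_exists (K : fieldType) (ts us : seq K) :
  (2%:R : K) != 0 -> sq_indep (us ++ ts) ->
  exists (L : fieldType) (j : {rmorphism K -> L}) S,
    symbol_map j ts S /\ sq_indep (map j us).
Proof.
move=> two; elim: ts us => [|t ts IH] us ind.
  exists K, idfun, (fun f => f`_0); split; last first.
    by rewrite map_id -[us]cats0.
  split=> //.
  - by move=> f g; rewrite coefD.
  - by move=> c f; rewrite coefZ map_poly_id.
  - by move=> f /=; rewrite ltnS leqn0 size_poly_eq0 => /eqP ->; rewrite mul0r coef0 size_poly0.
  - by move=> f g d e _ _ _; rewrite coef0M subrr size_poly0.
rewrite -cat_rcons in ind.
have [L' [j [S' [sS' ind']]]] := IH _ ind.
rewrite map_rcons in ind'.
have nsq := sq_indep_rcons_notsq ind'.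
have [L [i [s [sqs gen]]]] := quadratic_extension nsq.
exists L, (i \o j); eexists; split; first exact: symbol_step sS' sqs (quadratic_free sqs nsq).
rewrite map_comp; apply: (sq_indep_quadratic sqs _ gen ind').
by rewrite -(rmorph_nat j) fmorph_eq0.
Qed.

(** * Subfields and simple algebraic extensions *)

Section Subfield.
Variables (k : fieldType) (P : k -> bool) (closedP : GRing.divring_closed P).

HB.instance Definition _ := GRing.isDivringClosed.Build k P closedP.

Record subfield := Subfield { subfield_val : k; _ : P subfield_val }.

HB.instance Definition _ := [isSub for subfield_val].
HB.instance Definition _ := [Choice of subfield by <:].
HB.instance Definition _ := [SubChoice_isSubComUnitRing of subfield by <:].
HB.instance Definition _ := [SubComUnitRing_isSubIntegralDomain of subfield by <:].
HB.instance Definition _ := [SubIntegralDomain_isSubField of subfield by <:].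

Lemma subfield_embedding :
  exists (F : fieldType) (i : {rmorphism F -> k}),
    forall y, P y <-> exists z, i z = y.
Proof.
exists subfield, (val : {rmorphism subfield -> k}) => y; split.
  by move=> Py; exists (Subfield Py).
by case=> [[z Pz] <-].
Qed.
End Subfield.

Lemma subfield_of_closed (k : fieldType) (P : k -> Prop) :
  P 1 -> (forall x y, P x -> P y -> P (x - y)) ->
  (forall x y, P x -> P y -> P (x / y)) ->
  exists (F : fieldType) (i : {rmorphism F -> k}),
    forall y, P y <-> exists z, i z = y.
Proof.
move=> P1 PB Pdiv.
have closedP : GRing.divring_closed (fun y => `[< P y >]).
  split; first exact/asboolP.
    by move=> x y /asboolP Px /asboolP Py; exact/asboolP/PB.
  by move=> x y /asboolP Px /asboolP Py; exact/asboolP/Pdiv.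
have [F [i iP]] := subfield_embedding closedP.
by exists F, i => y; rewrite -iP; split=> [/asboolP|/asboolP].
Qed.

Section SimpleExtension.
Variables (F k : fieldType) (i : {rmorphism F -> k}).

(** Factors X of p are stripped, as x is nonzero; a relation with nonzero constant term is then
    solved for the inverse of x. *)
Lemma algebraic_inv_horner (p : {poly F}) (x : k) :
  x != 0 -> p != 0 -> root (map_poly i p) x ->
  exists g, x^-1 = (map_poly i g).[x].
Proof.
move=> xN0; elim/poly_ind: p => [|p c IH]; first by rewrite eqxx.
rewrite rmorphD rmorphM /= map_polyX map_polyC /= => pN0 /rootP.
rewrite !hornerE => /eqP px0.
have [c0|cN0] := eqVneq c 0.
  move: pN0 px0; rewrite c0 !rmorph0 !addr0 !mulf_eq0 negb_or.
  by rewrite (negPf xN0) orbF => /andP[pN0 _] px0; apply: IH.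
exists (- c^-1 *: p); rewrite map_polyZ hornerZ rmorphN fmorphV.
have icN0 : i c != 0 by rewrite fmorph_eq0.
apply: (mulIf xN0); rewrite mulVf // -mulrA.
move: px0; rewrite addr_eq0 => /eqP ->; by rewrite mulrN mulNr opprK mulVf.
Qed.

Lemma horner_reduce (m : {poly F}) (x : k) g : m != 0 -> root (map_poly i m) x ->
  exists2 g' : {poly F}, (size g' < size m)%N & (map_poly i g).[x] = (map_poly i g').[x].
Proof.
move=> mN0 /rootP mx; exists (g %% m); first by rewrite ltn_modp.
by rewrite {1}(divp_eq g m) rmorphD rmorphM hornerD hornerM mx mulr0 add0r.
Qed.

(** F[x] is closed under division: a nonzero z in F[x] is algebraic, so its inverse is a polynomial
    in z, hence in x. *)
Lemma simple_extension (x : k) : (forall y, algebraicOver i y) ->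
  exists (F' : fieldType) (i' : {rmorphism F' -> k}),
    forall y, (exists g, (map_poly i g).[x] = y) <-> exists z, i' z = y.
Proof.
move=> alg; apply: subfield_of_closed.
- by exists 1; rewrite rmorph1 hornerC.
- by move=> _ _ [g <-] [h <-]; exists (g - h); rewrite rmorphB hornerD hornerN.
move=> _ z [g <-] [h hz].
have [z0|zN0] := eqVneq z 0.
  by exists 0; rewrite z0 invr0 mulr0 rmorph0 horner0.
have [p pN0 pz] := alg z.
have [h' zV] := algebraic_inv_horner zN0 pN0 pz.
exists (g * (h' \Po h)).
by rewrite zV rmorphM hornerM /= map_comp_poly horner_comp hz.
Qed.
End SimpleExtension.

Lemma lift_poly (F F' k : fieldType) (i : {rmorphism F -> k})
    (i' : {rmorphism F' -> k}) :
  (forall c, exists c', i' c' = i c) ->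
  forall p, exists p', map_poly i' p' = map_poly i p.
Proof.
move=> sub; elim/poly_ind => [|p c [p' p'E]]; first by exists 0; rewrite !rmorph0.
have [c' c'E] := sub c; exists (p' * 'X + c'%:P).
by rewrite !rmorphD !rmorphM /= !map_polyX !map_polyC /= p'E c'E.
Qed.

Lemma algebraicOver_sub (F F' k : fieldType) (i : {rmorphism F -> k})
    (i' : {rmorphism F' -> k}) :
  (forall c, exists c', i' c' = i c) ->
  (forall y, algebraicOver i y) -> forall y, algebraicOver i' y.
Proof.
move=> sub alg y; have [p pN0 py] := alg y.
have [p' p'E] := lift_poly sub p.
by exists p'; rewrite ?p'E // -(map_poly_eq0 i') p'E map_poly_eq0.
Qed.

(** * Shifts modulo squares under algebraic extensions *)

Section SquareClasses.
Variables (k : fieldType) (two : (2%:R : k) != 0) (t : k).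

Definition shift_prod (I : seq nat) : k := \prod_(c <- I) (t - c%:R).

Definition shifts_indep (F : fieldType) (i : {rmorphism F -> k}) (N : nat) :=
  forall (I : seq nat) (z : F),
    uniq I -> all (leq N) I -> i z ^+ 2 = shift_prod I -> I = [::].

Definition has_shifts (F : fieldType) (i : {rmorphism F -> k}) :=
  forall I, exists z, i z = shift_prod I.

(* If a product of shifts becomes a square [w ^+ 2], dropping all shifts up to
   the largest one occurring in it restores independence over [F(w)]. *)
Lemma shifts_indep_quadratic (F F' : fieldType) (i : {rmorphism F -> k})
    (i' : {rmorphism F' -> k}) N I w :
  has_shifts i -> shifts_indep i N ->
  uniq I -> all (leq N) I -> I <> [::] -> w ^+ 2 = shift_prod I ->
  (forall y, (exists g, (map_poly i g).[w] = y) <-> exists z, i' z = y) ->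
  exists N', shifts_indep i' N'.
Proof.
move=> hs ind uI NI IN0 wI i'P.
have [u uI'] := hs I.
have nsq z : z ^+ 2 != u.
  by apply/eqP => zu; apply: IN0; apply: (ind I z) => //; rewrite -rmorphXn zu.
have gen z : exists x y, i' z = i x + i y * w.
  have [g gz] : exists g, (map_poly i g).[w] = i' z by apply/i'P; exists z.
  have sz : size ('X^2 - u%:P) = 3 by rewrite size_XnsubC.
  have [||h szh hE] := @horner_reduce _ _ i ('X^2 - u%:P) w g.
  - by rewrite -size_poly_eq0 sz.
  - by rewrite rmorphB /= map_polyXn map_polyC; apply/rootP; rewrite !hornerE wI /= uI' subrr.
  move: szh; rewrite sz ltnS => szh; exists h`_0, h`_1.
  rewrite -gz hE (@horner_coef_wide _ 2) ?size_map_poly //.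
  by rewrite !big_ord_recl big_ord0 /= !coef_map expr0 expr1 mulr1 addr0.
pose N' := (\max_(c <- I) c).+1.
have ltN' c : c \in I -> (c < N')%N.
  by move=> cI; rewrite ltnS; apply: leq_bigmax_seq.
exists (maxn N N') => J z uJ /allP NJ zJ.
have NJ1 : all (leq N) J.
  by apply/allP => c /NJ; rewrite geq_max => /andP[].
have [x [y zE]] := gen z; have [v vJ] := hs J.
have : i (x ^+ 2 + u * y ^+ 2 - v) + i (2%:R * x * y) * w = 0.
  rewrite !(rmorphB, rmorphD, rmorphM) /= rmorph1 vJ -zJ zE uI' -wI; ring.
case/(quadratic_free _ nsq) => [|/eqP h1 /eqP]; first by rewrite wI uI'.
have twoF : (2%:R : F) != 0 by rewrite -(fmorph_eq0 i) rmorph_nat.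
rewrite !mulf_eq0 (negPf twoF) /= => /orP[]/eqP z0; move: h1; rewrite z0 expr0n /=; last first.
  rewrite mulr0 addr0 subr_eq0 => /eqP xv.
  by apply: (ind J x) => //; rewrite -rmorphXn xv.
rewrite add0r subr_eq0 => /eqP yv.
(* Here v = u y^2, so u v = (u y)^2 is a square in F; I and J are disjoint because J starts beyond
   the maximum of I. *)
have := ind (I ++ J) (u * y); rewrite cat_uniq all_cat uI uJ NI NJ1 /= andbT.
have -> : ~~ has (fun x => x \in I) J.
  apply/hasPn => c cJ; apply/negP => /ltN'; have := NJ c cJ.
  by rewrite geq_max => /andP[_]; lia.
move=> /(_ isT isT) H.
have : I ++ J = [::].
  apply: H; rewrite /shift_prod big_cat /= -/(shift_prod I) -/(shift_prod J).
  by rewrite -uI' -vJ -yv !rmorphM; ring.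
by case: (I) IN0.
Qed.

(** Induction on the size of a polynomial m killing x. If independence fails in F(x), it yields w =
    g(x) outside F whose square is a product of shifts, with g smaller than m. Over F(w) the
    polynomial g - w kills x, and adjoining x to F(w) still gives F(x). *)
Lemma shifts_indep_simple d (F : fieldType) (i : {rmorphism F -> k}) N x
    (m : {poly F}) (F' : fieldType) (i' : {rmorphism F' -> k}) :
  (forall y, algebraicOver i y) -> has_shifts i -> shifts_indep i N ->
  m != 0 -> root (map_poly i m) x -> (size m <= d)%N ->
  (forall y, (exists g, (map_poly i g).[x] = y) <-> exists z, i' z = y) ->
  exists N', shifts_indep i' N'.
Proof.
elim: d F i N m => [|d IH] F i N m alg hs ind mN0 mx szm i'P.
  by move: szm; rewrite leqn0 size_poly_eq0 (negPf mN0).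
have [ind'|] := pselect (shifts_indep i' N); first by exists N.
move=> /existsNP[I] /existsNP[z] /not_implyP[uI] /not_implyP[NI] /not_implyP[zI IN0].
have [g0 g0z] : exists g, (map_poly i g).[x] = i' z by apply/i'P; exists z.
have [g szg gE] := horner_reduce g0 mN0 mx.
rewrite g0z in gE; set w := i' z in gE zI.
have wNF c : i c <> w.
  by move=> cw; apply: IN0; apply: (ind I c) => //; rewrite cw.
have [F1 [i1 i1P]] := simple_extension w alg.
have [N1 ind1] := shifts_indep_quadratic hs ind uI NI IN0 zI i1P.
have sub c : exists c', i1 c' = i c.
  by apply/i1P; exists c%:P; rewrite map_polyC hornerC.
have [p1 p1E] := lift_poly sub g.
have [w1 w1E] : exists z, i1 z = w by apply/i1P; exists 'X; rewrite map_polyX hornerX.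
apply: (IH F1 i1 N1 (p1 - w1%:P)) => //.
- exact: algebraicOver_sub sub alg.
- by move=> J; have [v <-] := hs J; exact: sub.
- apply/eqP => /(congr1 (map_poly i1)); rewrite rmorphB /= map_polyC /= p1E w1E rmorph0.
  move=> /eqP; rewrite subr_eq0 => /eqP gw; apply: (wNF g`_0).
  by rewrite -coef_map gw coefC.
- by apply/rootP; rewrite rmorphB /= map_polyC /= p1E w1E !hornerE -gE subrr.
- rewrite (leq_trans (size_polyD _ _)) // geq_max size_polyN.
  rewrite -(size_map_poly i1) p1E size_map_poly -ltnS (leq_trans szg) //=.
  rewrite (leq_trans (size_polyC_leq1 _)) //.
  (* The constant w also fits in the size bound d: g is not constant, since otherwise w would lie in
     F. *)
  case: (ltnP 1 (size g)) => [szg1|/size1_polyC gC].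
    by rewrite -ltnS; apply: leq_trans szm; apply: leq_trans szg; exact: ltnW.
  by case: (wNF g`_0); rewrite gE gC map_polyC hornerC coefC.
move=> y; rewrite -i'P; split=> [[g1 g1y]|[g1 g1y]].
  have [x' x'E] : exists z, i' z = x by apply/i'P; exists 'X; rewrite map_polyX hornerX.
  have sub' c : exists c', i' c' = i c.
    by apply/i'P; exists c%:P; rewrite map_polyC hornerC.
  have sub1 c : exists c', i' c' = i1 c.
    have [h hE] : exists h, (map_poly i h).[w] = i1 c by apply/i1P; exists c.
    have [h' h'E] := lift_poly sub' h.
    by exists h'.[z]; rewrite -hE -h'E horner_map.
  have [g2 g2E] := lift_poly sub1 g1.
  by apply/i'P; exists g2.[x']; rewrite -g1y -g2E -x'E horner_map.
by have [g2 g2E] := lift_poly sub g1; exists g2; rewrite g2E.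
Qed.
End SquareClasses.

Lemma shifts_indep_adjoin (k : fieldType) (t : k) (ss : seq k) (F : fieldType)
    (i : {rmorphism F -> k}) N :
  (2%:R : k) != 0 -> (forall y, algebraicOver i y) ->
  has_shifts t i -> shifts_indep t i N ->
  exists (F' : fieldType) (i' : {rmorphism F' -> k}) N',
    [/\ forall c, exists c', i' c' = i c,
        forall s, s \in ss -> exists z, i' z = s & shifts_indep t i' N'].
Proof.
move=> two; elim: ss F i N => [|s ss IH] F i N alg hs ind.
  by exists F, i, N; split=> // c; exists c.
have [F1 [i1 i1P]] := simple_extension s alg.
have [m mN0 ms] := alg s.
have [N1 ind1] := shifts_indep_simple two alg hs ind mN0 ms (leqnn _) i1P.
have sub c : exists c', i1 c' = i c.
  by apply/i1P; exists c%:P; rewrite map_polyC hornerC.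
have hs1 : has_shifts t i1 by move=> J; have [v <-] := hs J; exact: sub.
have [F' [i' [N' [sub' ss' ind']]]] := IH F1 i1 N1 (algebraicOver_sub sub alg) hs1 ind1.
exists F', i', N'; split=> // [c|r].
  by have [c1 <-] := sub c; exact: sub'.
rewrite inE => /orP[/eqP ->|]; last exact: ss'.
have [s1 <-] : exists z, i1 z = s by apply/i1P; exists 'X; rewrite map_polyX hornerX.
exact: sub'.
Qed.

(** * Shifts in a field of rational functions *)

Lemma mpoly_rmorph_ext (R : nzRingType) (A : nzRingType) n
    (f g : {rmorphism {mpoly R[n]} -> A}) :
  (forall c, f c%:MP = g c%:MP) -> (forall j, f 'X_j = g 'X_j) -> f =1 g.
Proof.
move=> fgC fgX; elim/mpolyind => [|c m p _ _ IH]; first by rewrite !rmorph0.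
rewrite !rmorphD IH -mul_mpolyC !rmorphM fgC; congr (_ * _ + _).
rewrite mpolyXE_id !rmorph_prod; apply: eq_bigr => j _.
by rewrite !rmorphXn /= fgX.
Qed.

Lemma poly_rmorph_exists (A B : comNzRingType) (f : {rmorphism A -> B}) (b : B) :
  exists g : {rmorphism {poly A} -> B}, (forall a, g a%:P = f a) /\ g 'X = b.
Proof.
exists (horner_eval b \o map_poly f); split=> [a|] /=.
  by rewrite map_polyC /horner_eval hornerC.
by rewrite map_polyX /horner_eval hornerX.
Qed.

Lemma univariate_exists (R : comNzRingType) n :
  exists u : {rmorphism {mpoly R[n.+1]} -> {poly {mpoly R[n]}}},
    [/\ injective u, forall c, u c%:MP = c%:MP%:P, u 'X_ord_max = 'X
      & forall j, u 'X_(lift ord_max j) = ('X_j)%:P].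
Proof.
pose u : {rmorphism {mpoly R[n.+1]} -> {poly {mpoly R[n]}}} :=
  mmap (polyC \o @mpolyC n R)
    (fun j => oapp (fun j' => ('X_j')%:P) 'X (unlift ord_max j)).
have uC c : u c%:MP = c%:MP%:P by rewrite /u /= mmapC.
have uX : u 'X_ord_max = 'X by rewrite /u /= mmapX mmap1U unlift_none.
have uXl j : u 'X_(lift ord_max j) = ('X_j)%:P by rewrite /u /= mmapX mmap1U liftK.
clearbody u; exists u; split=> //.
pose w : {rmorphism {mpoly R[n]} -> {mpoly R[n.+1]}} :=
  mmap (@mpolyC n.+1 R) (fun j => 'X_(lift ord_max j)).
have wC c : w c%:MP = c%:MP by rewrite /w /= mmapC.
have wX j : w 'X_j = 'X_(lift ord_max j) by rewrite /w /= mmapX mmap1U.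
clearbody w; have [g [gC gX]] := poly_rmorph_exists w 'X_ord_max.
apply: (can_inj (g := g)) => p.
apply: (mpoly_rmorph_ext (f := g \o u) (g := idfun)) => [c|j] /=.
  by rewrite uC gC wC.
by case: (unliftP ord_max j) => [j' ->|->]; rewrite ?uXl ?gC ?wX // uX gX.
Qed.

(** For nonzero Q the order at c would be even on the left and odd on the right. The proof is a
    descent: X - c divides P, then Q, and the quotients satisfy the same equation. *)
Lemma simple_root_not_square (A : idomainType) (c : A) (P Q S : {poly A}) :
  ~~ root S c -> P ^+ 2 = Q ^+ 2 * ('X - c%:P) * S -> Q = 0.
Proof.
move=> Sc; have [d] := ubnP (size Q); elim: d P Q => // d IH P Q szQ PQ.
have XN0 : 'X - c%:P != 0 :> {poly A} by rewrite polyXsubC_eq0.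
have /factor_theorem[P1 P1E] : root P c.
  have /eqP : (P ^+ 2).[c] = 0 by rewrite PQ !hornerM hornerXsubC subrr mulr0 mul0r.
  by rewrite horner_exp sqrf_eq0.
have PQ1 : Q ^+ 2 * S = P1 ^+ 2 * ('X - c%:P).
  by apply: (mulIf XN0); rewrite mulrAC -PQ P1E; ring.
have /factor_theorem[Q1 Q1E] : root Q c.
  have /eqP : (Q ^+ 2 * S).[c] = 0 by rewrite PQ1 !hornerM hornerXsubC subrr mulr0.
  rewrite hornerM mulf_eq0 horner_exp sqrf_eq0 => /orP[//|S0].
  by case/negP: Sc.
have [Q10|Q1N0] := eqVneq Q1 0; first by rewrite Q1E Q10 mul0r.
suff Q10 : Q1 = 0 by rewrite Q10 eqxx in Q1N0.
apply: (IH P1 Q1).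
  by move: szQ; rewrite Q1E size_Mmonic ?monicXsubC // size_XsubC addn2 /= ltnS.
by apply: (mulIf XN0); rewrite -PQ1 Q1E; ring.
Qed.

Lemma fraction_subfield (A : idomainType) (k : fieldType) (e : {rmorphism A -> k}) :
  injective e ->
  (forall y, exists2 p : {poly A}, p != 0 & root (map_poly e p) y) ->
  exists (F : fieldType) (i : {rmorphism F -> k}),
    (forall y, (exists p q, q != 0 /\ y = e p / e q) <-> exists z, i z = y) /\
    forall y, algebraicOver i y.
Proof.
move=> e_inj e_alg.
have eN0 p : p != 0 -> e p != 0 by rewrite -(inj_eq e_inj) rmorph0.
have [|||F [i iP]] := @subfield_of_closed k (fun y => exists p q, q != 0 /\ y = e p / e q).
- by exists 1, 1; rewrite rmorph1 divr1 oner_eq0.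
- move=> _ _ [p [q [qN0 ->]]] [p' [q' [qN0' ->]]].
  exists (p * q' - p' * q), (q * q'); rewrite mulf_neq0 //; split=> //.
  by rewrite rmorphB !rmorphM /=; field; rewrite !eN0.
- move=> _ _ [p [q [qN0 ->]]] [p' [q' [qN0' ->]]].
  have [->|pN0'] := eqVneq p' 0.
    by exists 0, 1; rewrite oner_eq0 rmorph0 !mul0r invr0 mulr0.
  exists (p * q'), (q * p'); rewrite mulf_neq0 //; split=> //.
  by rewrite !rmorphM invf_div mulf_div.
have esub p : exists z, i z = e p.
  by apply/iP; exists p, 1; rewrite oner_eq0 rmorph1 divr1.
exists F, i; split=> // y; have [p pN0 py] := e_alg y.
have [p' p'E] : exists p', map_poly i p' = map_poly e p.
  elim/poly_ind: (p) => [|q c [q' q'E]]; first by exists 0; rewrite !rmorph0.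
  have [c' c'E] := esub c; exists (q' * 'X + c'%:P).
  by rewrite !rmorphD !rmorphM /= !map_polyX !map_polyC /= q'E c'E.
exists p'; last by rewrite p'E.
rewrite -(map_poly_eq0 i) p'E; apply: contra pN0 => /eqP p0.
by apply/eqP/polyP => j; apply: e_inj; rewrite -coef_map p0 !coef0 rmorph0.
Qed.

Lemma natr_inj_pchar0 (K : fieldType) (A : idomainType) (f : {rmorphism K -> A}) :
  [pchar K] =i pred0 -> forall a b : nat, a%:R = b%:R :> A -> a = b.
Proof.
move=> char0; have nz c : (c.+1%:R : A) != 0.
  by rewrite -(rmorph_nat f) fmorph_eq0 ((pcharf0P K).1 char0).
move=> a b; wlog le_ab : a b / (a <= b)%N => [H|].
  by case: (leqP a b) => [/H //|/ltnW /H Hba /esym /Hba].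
rewrite -(subnK le_ab) natrD => /eqP; rewrite eq_sym -subr_eq0 addrK.
by case: (b - a)%N => // c; rewrite (negPf (nz c)).
Qed.

(** After clearing denominators, a square product of shifts reads p^2 = q^2 times a product of
    linear factors in the last variable. In characteristic zero the shifts are distinct, so c0 is a
    simple root of that product. *)
Lemma shifts_indep_mpoly (k0 k F : fieldType) n (e : {rmorphism {mpoly k0[n.+1]} -> k})
    (i : {rmorphism F -> k}) :
  [pchar k0] =i pred0 -> injective e ->
  (forall y, (exists p q, q != 0 /\ y = e p / e q) <-> exists z, i z = y) ->
  has_shifts (e 'X_ord_max) i /\ shifts_indep (e 'X_ord_max) i 0.
Proof.
move=> char0 e_inj iP; set t := e 'X_ord_max.
have shiftE I : shift_prod t I = e (\prod_(c <- I) ('X_ord_max - c%:R)).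
  rewrite rmorph_prod; apply: eq_bigr => c _.
  by rewrite rmorphB rmorph_nat.
split.
  move=> I; rewrite shiftE; apply/iP.
  by eexists; exists 1; rewrite oner_eq0 rmorph1 divr1.
case=> // c0 I z /= /andP[c0I uI] _ zI.
have [p [q [qN0 zE]]] : exists p q, q != 0 /\ i z = e p / e q by apply/iP; exists z.
have eqN0 : e q != 0 by rewrite -(rmorph0 e) (inj_eq e_inj).
have pq : p ^+ 2 = q ^+ 2 * \prod_(c <- c0 :: I) ('X_ord_max - c%:R).
  apply: e_inj; rewrite rmorphM -shiftE -zI zE !rmorphXn expr_div_n mulrC divfK //.
  by rewrite expf_neq0.
have nat_inj : forall a b : nat, a%:R = b%:R :> {mpoly k0[n]} -> a = b.
  exact: natr_inj_pchar0 (@mpolyC n k0) char0.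
have [u [u_inj _ uX _]] := univariate_exists k0 n.
suff /eqP : u q = 0 by rewrite -(rmorph0 u) (inj_eq u_inj) (negPf qN0).
apply: (@simple_root_not_square _ c0%:R (u p) (u q) (\prod_(c <- I) ('X - c%:R%:P))).
  rewrite /root horner_prod prodf_seq_neq0; apply/allP => c cI /=.
  by rewrite hornerXsubC subr_eq0; apply/eqP => /nat_inj cc0; rewrite cc0 cI in c0I.
have uF c : u ('X_ord_max - c%:R) = 'X - c%:R%:P.
  by rewrite (rmorphB u) uX (rmorph_nat u) polyC_natr.
have uprod : u (\prod_(c <- I) ('X_ord_max - c%:R)) = \prod_(c <- I) ('X - c%:R%:P).
  by rewrite (rmorph_prod u); apply: eq_bigr.
rewrite -uprod.
rewrite -uF.
transitivity (u (p ^+ 2)); first by rewrite (rmorphXn u).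
rewrite pq big_cons mulrA (rmorphM u).
congr (_ * _).
by rewrite (rmorphM u) (rmorphXn u).
Qed.

(** * Transcendence bases and independent shifts in a function field *)

Section TranscendenceBasis.
Variables (k0 k : fieldType) (iota : {rmorphism k0 -> k}).

Definition mpoly_eval n (w : 'I_n -> k) : {rmorphism {mpoly k0[n]} -> k} :=
  meval w \o map_mpoly iota.

Lemma mpoly_evalE n (w : 'I_n -> k) p : mpoly_eval w p = (map_mpoly iota p).@[w] :> k.
Proof. by []. Qed.

Lemma mpoly_evalC n w c : @mpoly_eval n w c%:MP = iota c.
Proof. by rewrite mpoly_evalE map_mpolyC mevalC. Qed.

Lemma mpoly_evalX n w j : @mpoly_eval n w 'X_j = w j.
Proof. by rewrite mpoly_evalE map_mpolyX mevalXU. Qed.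

Lemma mpoly_eval_inj n (w : 'I_n -> k) :
  alg_independent iota w -> injective (mpoly_eval w).
Proof.
move=> ind p q /eqP; rewrite -subr_eq0 -rmorphB => /eqP /ind /eqP.
by rewrite subr_eq0 => /eqP.
Qed.

(** By maximality, v extended by y as last member satisfies a nontrivial relation; read in its last
    variable, it is the required polynomial. *)
Lemma maximal_algebraic n (v : 'I_n -> k) :
  alg_independent iota v ->
  (forall (m : nat) (w : 'I_m -> k), alg_independent iota w -> (m <= n)%N) ->
  forall y, exists2 p, p != 0 & root (map_poly (mpoly_eval v) p) y.
Proof.
move=> v_indep v_max y.
pose w j := oapp v y (unlift ord_max j).
have : ~ alg_independent iota w by move=> /v_max; rewrite ltnn.
move=> /existsNP[p /not_implyP[pw pN0]].
have [u [u_inj uC uX uXl]] := univariate_exists k0 n.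
exists (u p); first by rewrite -(rmorph0 u) (inj_eq u_inj); apply/eqP.
have [g [gC gX]] := poly_rmorph_exists (mpoly_eval v) y.
have gE q : (map_poly (mpoly_eval v) q).[y] = g q.
  elim/poly_ind: q => [|q c IH]; first by rewrite !rmorph0 horner0.
  by rewrite !rmorphD !rmorphM /= map_polyX map_polyC hornerMXaddC IH gC gX.
apply/rootP; rewrite gE -pw -mpoly_evalE.
apply: (mpoly_rmorph_ext (f := g \o u)) => [c|j]; rewrite -[LHS]/(g (u _)).
  by rewrite uC gC !mpoly_evalC.
rewrite mpoly_evalX /w; case: (unliftP ord_max j) => [j' ->|->].
  by rewrite uXl gC mpoly_evalX.
by rewrite uX gX.
Qed.
End TranscendenceBasis.

Lemma independent_shifts (k0 k : fieldType) (iota : {rmorphism k0 -> k}) :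
  [pchar k0] =i pred0 -> function_field iota ->
  exists (t : k) (N : nat), forall (I : seq nat) (z : k),
    uniq I -> all (leq N) I -> z ^+ 2 = shift_prod t I -> I = [::].
Proof.
move=> char0 [[ss fg] [[//|n] _ [[v v_indep] v_max]]].
have two : (2%:R : k) != 0.
  by rewrite -(rmorph_nat iota) fmorph_eq0 ((pcharf0P k0).1 char0).
pose e := mpoly_eval iota v; have e_inj : injective e := mpoly_eval_inj v_indep.
have [F [i [iP alg]]] := fraction_subfield e_inj (maximal_algebraic v_indep v_max).
have [hs ind] := shifts_indep_mpoly char0 e_inj iP.
have [F' [i' [N [sub ss' ind']]]] := shifts_indep_adjoin ss two alg hs ind.
(* The image of F' is a subfield containing k0 and the generators [ss], hence is all of k. *)
have full x : exists z, i' z = x.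
  suff : x \in (fun y => `[< exists z, i' z = y >] : bool) by move/asboolP.
  apply: fg => [|c|s s_in]; last 2 first.
  - apply/asboolP; have [z <-] : exists z, i z = iota c; last exact: sub.
    by apply/iP; exists c%:MP, 1; rewrite oner_eq0 rmorph1 divr1 mpoly_evalC.
  - exact/asboolP/ss'.
  split; first by apply/asboolP; exists 1; rewrite rmorph1.
    by move=> _ _ /asboolP[y <-] /asboolP[z <-]; apply/asboolP; exists (y - z); rewrite rmorphB.
  by move=> _ _ /asboolP[y <-] /asboolP[z <-]; apply/asboolP; exists (y / z); rewrite fmorph_div.
exists (e 'X_ord_max), N => I z uI NI zI; have [z' z'E] := full z.
by apply: (ind' I z') => //; rewrite z'E.
Qed.

Lemma sq_indep_shifts (k : fieldType) (t : k) N M :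
  (forall (I : seq nat) (z : k),
    uniq I -> all (leq N) I -> z ^+ 2 = shift_prod t I -> I = [::]) ->
  sq_indep (mkseq (fun j => t - (N + j)%:R) M).
Proof.
move=> ind m z; rewrite size_mkseq /mkseq => szm.
have -> : [seq t - (N + j)%:R | j <- iota 0 M] = [seq t - c%:R | c <- iota N M].
  by rewrite -[N in RHS]addn0 iotaDl -map_comp.
rewrite -map_mask big_map => zE.
have m0 : mask m (iota N M) = [::].
  apply: ind zE; first by rewrite mask_uniq ?iota_uniq.
  by apply/allP => c /mem_mask; rewrite mem_iota => /andP[].
by rewrite has_count -(@size_mask _ m (iota N M)) ?size_iota ?m0.
Qed.

(** * The weight as a degree function *)

Section DegreeFunction.
Variables (k : fieldType) (tau : nat -> k).
Hypotheses (two : (2%:R : k) != 0) (tau_indep : forall M, sq_indep (mkseq tau M)).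
Implicit Types f g : {poly {poly k}}.

(** [size f] levels suffice because n <= 2^n; by [weightE] every sufficient number of levels gives
    the same value. *)
Definition weight f : nat := wsize (mkseq tau (size f)) f.

Lemma weightE M f : (size f <= 2 ^ M)%N -> weight f = wsize (mkseq tau M) f.
Proof.
move=> szf; have catE a b : mkseq tau (a + b) = mkseq tau a ++ mkseq (tau \o addn a) b.
  by rewrite /mkseq iotaD map_cat add0n -[in iota a b](addn0 a) iotaDl -map_comp.
have : wsize (mkseq tau (size f + M)) f = weight f.
  by rewrite catE wsize_stable // size_mkseq ltnW // ltn_expl.
by rewrite addnC catE wsize_stable ?size_mkseq.
Qed.

Lemma weight_symbol M : exists (L : fieldType) (j : {rmorphism k -> L}) S,
  symbol_map j (mkseq tau M) S.
Proof.
have [L [j [S [sS _]]]] := @symbol_exists k (mkseq tau M) [::] two (@tau_indep M).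
by exists L, j, S.
Qed.

Lemma weightC (c : {poly k}) : weight c%:P = size c.
Proof. exact: wsizeC. Qed.

Lemma weight_eq0 f : (weight f == 0%N) = (f == 0).
Proof.
apply/eqP/eqP => [|->]; last by rewrite -polyC0 weightC size_poly0.
by apply: wsize_eq0; rewrite size_mkseq ltnW // ltn_expl.
Qed.

Lemma weightD f g : (weight (f + g) <= maxn (weight f) (weight g))%N.
Proof.
pose M := (size f + size g)%N.
have lt_M m : (m <= M)%N -> (m <= 2 ^ M)%N.
  by move=> /leq_trans -> //; rewrite ltnW // ltn_expl.
have [L [j [S sS]]] := weight_symbol M.
have szfg : (size (f + g)%R <= M)%N.
  by rewrite (leq_trans (size_polyD _ _)) // geq_max leq_addr leq_addl.
rewrite !(@weightE M) ?lt_M ?leq_addr ?leq_addl // -!(size_sym sS) (symD sS).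
exact: size_polyD.
Qed.

(** The symbol of f g is S f * S g up to lower degree, and the leading term of S f * S g survives
    since L[X] is a domain. The predecessor appears because weights are degrees plus one. *)
Lemma weightM f g : f != 0 -> g != 0 -> weight (f * g) = (weight f + weight g).-1.
Proof.
move=> fN0 gN0; pose M := (size f + size g)%N.
have lt_M m : (m <= M)%N -> (m <= 2 ^ M)%N.
  by move=> /leq_trans -> //; rewrite ltnW // ltn_expl.
have [L [j [S sS]]] := weight_symbol M.
have szfg : (size (f * g)%R <= M)%N by rewrite (leq_trans (size_polyMleq _ _)) ?leq_pred.
have wf : weight f = size (S f) by rewrite (size_sym sS) -weightE ?lt_M ?leq_addr.
have wg : weight g = size (S g) by rewrite (size_sym sS) -weightE ?lt_M ?leq_addl.
have SfN0 : S f != 0 by rewrite -size_poly_eq0 -wf weight_eq0.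
have SgN0 : S g != 0 by rewrite -size_poly_eq0 -wg weight_eq0.
have := @size_symM _ _ _ _ _ sS f g (size (S f)).-1 (size (S g)).-1.
rewrite size_mkseq !leqSpred => /(_ _ isT isT) h.
rewrite (@weightE M) ?lt_M // -(size_sym sS) wf wg -size_mul //.
rewrite -[S (f * g)](subrK (S f * S g)) addrC size_polyDl // size_mul //.
apply: leq_ltn_trans (h _) _; first by rewrite ltnW // ltnS lt_M.
by rewrite (polySpred SfN0) (polySpred SgN0) addSn addnS.
Qed.

Lemma weightN f : weight (- f) = weight f.
Proof.
have [->|fN0] := eqVneq f 0; first by rewrite oppr0.
rewrite -mulN1r weightM ?oppr_eq0 ?oner_eq0 //.
by rewrite -polyC1 -polyCN weightC size_polyN size_poly1.
Qed.

Lemma weightDl f g : (weight g < weight f)%N -> weight (f + g) = weight f.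
Proof.
move=> lt_gf; have := weightD f g; have := weightD (f + g) (- g).
by rewrite addrK weightN; lia.
Qed.

(** * Key polynomials and their derivatives *)

Definition key_step (z : {poly {poly k}}) t := z ^+ 2 - cst t.

Lemma key_comp ts z q : foldl key_step (z \Po q) ts = foldl key_step z ts \Po q.
Proof.
elim: ts z => //= t ts IH z; rewrite -IH; congr foldl.
by rewrite /key_step comp_polyB rmorphXn /= comp_polyC.
Qed.

(** By [key_comp] the key polynomial of u :: ts is that of ts evaluated at Y^2 - u X^2, so its odd
    coordinate is zero. The induction ends at Y, which the extra entry t serves to split. *)
Lemma wsize_key ts t : wsize (rcons ts t) (foldl key_step 'X ts) = 2.
Proof.
elim: ts => [|u ts IH] /=.
  have -> : 'X = 1%:P * 'X :> {poly {poly k}} by rewrite mul1r.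
  by rewrite evMX odMX odC evC mul0r coef0 size_poly0 coefC size_poly1.
have -> : key_step 'X u = 'X \Po ('X ^+ 2 - cst u) by rewrite comp_polyX.
by rewrite key_comp; have [-> ->] := evod_comp u (foldl key_step 'X ts); rewrite IH wsize0.
Qed.

Lemma size_key ts : (size (foldl key_step 'X ts) <= (2 ^ size ts).+1)%N.
Proof.
elim/last_ind: ts => [|ts t IH]; first by rewrite size_polyX.
rewrite foldl_rcons size_rcons (leq_trans (size_polyD _ _)) // geq_max.
rewrite size_polyN (leq_trans (size_polyC_leq1 _)) // andbT.
rewrite (leq_trans (size_polyMleq _ _)) // expnS; lia.
Qed.

Definition to_poly2 : {mpoly k[2]} -> {poly {poly k}} :=
  mmap (polyC \o polyC) (fun j => if j == ord0 then 'X%:P else 'X).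

HB.instance Definition _ := GRing.RMorphism.on to_poly2.

Lemma to_poly2C c : to_poly2 c%:MP = c%:P%:P.
Proof. by rewrite /to_poly2 mmapC. Qed.

Lemma to_poly2X0 : to_poly2 'X_ord0 = 'X%:P.
Proof. by rewrite /to_poly2 mmapX mmap1U. Qed.

Lemma to_poly2X1 : to_poly2 'X_ord_max = 'X.
Proof. by rewrite /to_poly2 mmapX mmap1U. Qed.

Lemma to_poly2_inj : injective to_poly2.
Proof.
have [h [hC hX]] := poly_rmorph_exists (@mpolyC 2 k) 'X_ord0.
have [g [gC gX]] := poly_rmorph_exists h 'X_ord_max.
apply: (can_inj (g := g)) => p.
apply: (mpoly_rmorph_ext (f := g \o to_poly2) (g := idfun)) => [c|j] /=.
  by rewrite to_poly2C gC hC.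
have [->|jN0] := eqVneq j ord0; first by rewrite to_poly2X0 gC hX.
have -> : j = ord_max by apply/val_inj; case: j jN0 => [[|[]]].
by rewrite to_poly2X1 gX.
Qed.

Definition wdeg (p : {mpoly k[2]}) : zbot :=
  if weight (to_poly2 p) is w.+1 then Some w%:Z else None.

Lemma wdeg_eq_None p : wdeg p = None <-> p = 0.
Proof.
have : (weight (to_poly2 p) == 0%N) = (p == 0).
  by rewrite weight_eq0 -(rmorph0 to_poly2) (inj_eq to_poly2_inj).
rewrite /wdeg; case: (weight _) => [|w] /esym pE; split=> //.
  by move/eqP: pE.
by move/eqP; rewrite pE.
Qed.

Lemma nat_degree_function_wdeg : nat_degree_function wdeg.
Proof.
split; last first.
  move=> p pN0; case E: (wdeg p) => [w|].
    by move: E; rewrite /wdeg; case: (weight _) => // n [<-]; exists n.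
  by move/wdeg_eq_None: E pN0 => ->; rewrite eqxx.
split; first exact: wdeg_eq_None.
  move=> p q; have [->|pN0] := eqVneq p 0.
    by rewrite mul0r (wdeg_eq_None 0).2.
  have [->|qN0] := eqVneq q 0.
    by rewrite mulr0 (wdeg_eq_None 0).2 //; case: (wdeg p).
  have N0 r : r != 0 -> to_poly2 r != 0.
    by rewrite -(rmorph0 to_poly2) (inj_eq to_poly2_inj).
  rewrite /wdeg rmorphM weightM ?N0 //.
  move: (N0 p pN0) (N0 q qN0); rewrite -!weight_eq0.
  case: (weight _) => // a; case: (weight _) => // b _ _.
  by rewrite addSn addnS.
move=> p q; rewrite /wdeg rmorphD.
have := weightD (to_poly2 p) (to_poly2 q).
case: (weight (_ + _)) => // c; case: (weight _) => [|a]; case: (weight _) => [|b] //=.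
by rewrite /zbot_max /=; case: ifP => /=; lia.
Qed.

Lemma wdegC c : c != 0 -> wdeg c%:MP = Some 0.
Proof. by move=> cN0; rewrite /wdeg to_poly2C weightC size_polyC cN0. Qed.

Fixpoint key (n : nat) : {mpoly k[2]} :=
  if n is n'.+1 then key n' ^+ 2 - tau n' *: 'X_ord0 ^+ 2 else 'X_ord_max.

Lemma to_poly2_key n : to_poly2 (key n) = foldl key_step 'X (mkseq tau n).
Proof.
elim: n => [|n IH]; first exact: to_poly2X1.
rewrite mkseqS foldl_rcons -IH /= rmorphB rmorphXn -mul_mpolyC rmorphM rmorphXn /=.
by rewrite to_poly2C to_poly2X0 /key_step /cst -mul_polyC polyCM rmorphXn.
Qed.

Lemma weight_key n : weight (to_poly2 (key n)) = 2.
Proof.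
rewrite to_poly2_key (@weightE n.+1) ?mkseqS ?wsize_key //.
apply: leq_trans (size_key _) _; rewrite size_mkseq expnS.
by have := expn_gt0 2 n; lia.
Qed.

Lemma tau_neq0 n : tau n != 0.
Proof.
have := @tau_indep n.+1; rewrite mkseqS => /sq_indep_rcons_notsq /(_ 0).
by rewrite expr0n eq_sym.
Qed.

(** In p_(m+1)' = 2 p_m p_m' - 2 tau_m X, the factor p_m of degree 1 raises the degree of p_m' by
    one, and for m >= 1 the product dominates the last term, of degree 1. The induction starts at
    p_1' = -2 tau_0 X, as p_0' = 0. *)
Lemma weight_deriv_key n :
  weight (to_poly2 (mderiv (ord0 : 'I_2) (key n.+1))) = n.+2.
Proof.
have DX : mderiv (ord0 : 'I_2) 'X_ord0 = 1 :> {mpoly k[2]}.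
  by rewrite mderivX mnm1E eqxx scale1r -[X in (X - _)%MM]add0m addmK mpolyX0.
have DX0 : mderiv (ord0 : 'I_2) ('X_ord0 ^+ 2) = 2%:R * 'X_ord0 :> {mpoly k[2]}.
  by rewrite expr2 mderivM DX; ring.
have lowE m : weight (to_poly2 (tau m *: (2%:R * 'X_ord0))) = 2.
  rewrite -mul_mpolyC !(rmorphM to_poly2) (rmorph_nat to_poly2) /= to_poly2C to_poly2X0.
  rewrite -polyC_natr -polyC_natr -!polyCM weightC mulrA -polyCM mul_polyC size_scale ?size_polyX // mulf_neq0 ?tau_neq0 //.
elim: n => [|n IH].
  have DX1 : mderiv (ord0 : 'I_2) 'X_ord_max = 0 :> {mpoly k[2]}.
    by rewrite mderivX mnm1E scale0r.
  rewrite /= mderivB mderivZ DX0 expr2 mderivM DX1 mul0r mulr0 addr0 sub0r.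
  by rewrite rmorphN weightN lowE.
have -> : key n.+2 = key n.+1 ^+ 2 - tau n.+1 *: 'X_ord0 ^+ 2 by [].
rewrite mderivB mderivZ DX0 expr2 mderivM.
move: (key n.+1) (weight_key n.+1) IH => q wq; move: (mderiv _ q) => q' wq'.
have N0 w f : weight f = w.+1 -> f != 0 by rewrite -weight_eq0 => ->.
have -> : q' * q + q * q' = 2%:R%:MP * (q * q').
  by rewrite mpolyC_nat; ring.
have wE : weight (to_poly2 (2%:R%:MP * (q * q'))) = n.+3.
  rewrite !(rmorphM to_poly2) /= to_poly2C weightM ?mulf_neq0 ?polyC_eq0 ?(N0 _ _ wq) ?(N0 _ _ wq') //.
  by rewrite weightC size_polyC two weightM ?(N0 _ _ wq) ?(N0 _ _ wq') // wq wq'.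
by rewrite (rmorphB to_poly2) weightDl wE // weightN lowE.
Qed.

Lemma wdeg_deriv_not_defined : ~ degree_defined wdeg (mderiv (ord0 : 'I_2)).
Proof.
case=> u _ bound.
have shift n : zbot_le (Some n%:Z) u.
  suff -> : Some n%:Z = zbot_sub (wdeg (mderiv (ord0 : 'I_2) (key n.+1))) (wdeg (key n.+1)).
    apply: bound; exists (key n.+1) => //.
    apply/eqP => k0; have := weight_key n.+1.
    by rewrite k0 rmorph0 -polyC0 weightC size_poly0.
  by rewrite /wdeg weight_deriv_key weight_key /= -addn1 PoszD addrK.
(* The shift |z| + 1 exceeds a finite bound z, and the shift 0 exceeds -oo. *)
by case: u bound shift => [z|] _ shift; [have := shift `|z|.+1 | have := shift 0%N]; rewrite /=; lia.
Qed.
End DegreeFunction.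

Theorem proposition1p4 (k0 k : fieldType) (iota : {rmorphism k0 -> k})
    (k0_char0 : [pchar k0] =i pred0)
    (k0_uncountable : ~ countable [set: k0]%classic)
    (k_function_field : function_field iota) :
  exists deg : {mpoly k[2]} -> zbot,
    [/\ nat_degree_function deg,
        forall c : k, c != 0 -> deg c%:MP = Some 0
      & ~ degree_defined deg (mderiv (ord0 : 'I_2))].
Proof.
have [t [N ind]] := independent_shifts k0_char0 k_function_field.
have two : (2%:R : k) != 0.
  by rewrite -(rmorph_nat iota) fmorph_eq0 ((pcharf0P k0).1 k0_char0).
have tau_indep M := sq_indep_shifts (M := M) ind.
exists (wdeg (fun j => t - (N + j)%:R)); split.
- exact: nat_degree_function_wdeg.
- exact: wdegC.
- exact: wdeg_deriv_not_defined.
Qed.
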